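(* Let $\mathcal K$ be a nonempty pseudovariety of finite groups, and for each group $G$ put $$\mathcal N_{\mathcal K}(G)=\{U\le G\mid N\le U\text{ for some }N\trianglelefteq G\text{ with }G/N\in\mathcal K\}.$$ Then $\mathcal N_{\mathcal K}$ is the kernel of an extensional presentation of the minimally distributive subgroup form over $\mathbf{Grp}$. Its associated non-Archimedean group topology is the pro-$\mathcal K$ topology, and its Hausdorff objects are exactly the residually $\mathcal K$ groups. In particular, the choices of all finite groups, all finite $p$-groups, all finite solvable groups, and all finite nilpotent groups give respectively the profinite, pro-$p$, prosolvable, and pronilpotent topologies with their familiar residual classes (the residually finite, residually finite-$p$, residually finite-solvable, and residually finite-nilpotent groups).
   Context: **Size.** The base category $\mathcal C=\mathbf{Grp}$ (groups and homomorphisms) is treated as small relative to a suitable universe. **Forms.** A form over $\mathcal C$ with finite indexed meets is (equivalently) a functor $F:\mathcal C^{\mathrm{op}}\to\mathbf{Meet}_\top$, where $\mathbf{Meet}_\top$ is the category of meet-semilattices with top and maps preserving finite meets (including top). Elements of $F_X$ are called clusters over $X$; $f^*:F_Y\to F_X$ is the action of $f:X\to Y$; $\top_X$ is the top of $F_X$. For a small family $(A_i,f_i)_i$ with $f_i:X_i\to X$, $A_i\in F_{X_i}$, its final lift, if it exists, is the least $U\in F_X$ with $A_i\le f_i^*U$ for all $i$; one writes $U=\nabla_i(A_i,f_i)$ and calls the whole datum a final presentation. **Distributivity forms.** A distributivity form is a form $F$ with finite indexed meets together with a class of final presentations, called admissible, such that: (D1) every unit presentation $A=\nabla(A,1_X)$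 is admissible, and admissibility is invariant under bijective reindexing; (D2) if $U=\nabla_i(A_i,f_i)$ and $A_i=\nabla_j(B_{ij},g_{ij})$ (all $i$) are admissible, so is $U=\nabla_{i,j}(B_{ij},f_ig_{ij})$; (D3) if $U=\nabla_i(A_i,f_i)$ is admissible and $C\in F_X$, then $U\wedge C=\nabla_i(A_i\wedge f_i^*C,f_i)$ is an admissible final presentation. The minimal distributivity is the one in which only unit presentations are admissible. A morphism $u:F\to G$ is a natural transformation with finite-meet-preserving components sending each admissible $U=\nabla_i(A_i,f_i)$ to an admissible final presentation $u_X(U)=\nabla_i(u_{X_i}(A_i),f_i)$. **Extensional presentations.** A morphism $n:F\to G$ is null if $n_X(A)=\top_X$ for all $X$ and $A\in F_X$. A relative kernel of $u:F\to G$ is a morphism $k:K\to F$ with $uk$ null through which every $h:H\to F$ with $uh$ null factors uniquely; relative cokernels are dual. $K\xrightarrow{k}F\xrightarrow{q}Q$ is short exact if $k$ is a kernel of $q$ and $q$ is a cokernel of $k$. An extensional presentation of $F$ is an isomorphism class, fixing $F$, of short exact sequences with middle term $F$; its kernel term is identified with the subform $K_X=\{A\in F_X\mid q_X(A)=\top_X\}$. If $F_X$ has a least cluster $\bot_X$, $X$ is Hausdorff for the extensional presentation if $\bot_X$ is the greatest lower bound of $K_X$ in $F_X$. **Subgroup form.** $\operatorname{Sub}$ has as clusters over $G$ the subgroups of $G$ ordered by inclusion, with $A\wedge B=A\cap B$, $f^*B=f^{-1}(B)$. A topological group is non-Archimedean if it has a neighbourhood basis at the identity of open subgroups (Hausdorffness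 not required). The group topology associated with an extensional presentation with kernel $\mathcal N$ is the one in which $O\subseteq G$ is open iff each $x\in O$ has $xU\subseteq O$ for some $U\in\mathcal N(G)$. **Pseudovarieties.** A pseudovariety of finite groups is a class of finite groups closed under finite products, subgroups and quotients. The pro-$\mathcal K$ topology on $G$ is the group topology with neighbourhood basis at the identity the normal subgroups $N$ with $G/N\in\mathcal K$. $G$ is residually $\mathcal K$ if every non-identity element has non-trivial image under some homomorphism from $G$ to a member of $\mathcal K$. *)

(* Defs.v *)
From HB Require Import structures.
From mathcomp Require Import all_boot all_order all_fingroup all_solvable.
From mathcomp Require Import mathcomp_extra boolp classical_sets functions.
From mathcomp Require Import topology.

Set Implicit Arguments.
Unset Strict Implicit.
Unset Printing Implicit Defensive.

Import Order.TTheory.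

Local Open Scope classical_set_scope.
Local Open Scope group_scope.

(* Objects are the (possibly infinite) groups [groupType] of
   mathcomp.boot.monoid, arrows its unital multiplicative maps. *)
Notation hom G H := (UMagmaMorphism.type (G : groupType) (H : groupType)).

Definition id_hom (G : groupType) : hom G G := idfun.
Definition comp_hom (G H L : groupType) (g : hom H L) (f : hom G H) : hom G L :=
  g \o f.

Lemma hom_ext (G H : groupType) (f g : hom G H) : f =1 g -> f = g.
Proof.
case: f g => f cf [g cg] /= /funext fg; case: _ / fg cg => cg.
congr UMagmaMorphism.Pack; case: cf cg => [[p] [q]] [[p'] [q']].
by rewrite (Prop_irrelevance p p') (Prop_irrelevance q q').
Qed.

(* Displays of order structures only drive notations, so one may be fixed. *)
Fact form_display : Order.disp_t. Proof. exact: Order.Disp tt tt. Qed.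

Definition finite_meet_morphism d d' (L : tMeetSemilatticeType d)
    (M : tMeetSemilatticeType d') (f : L -> M) : Prop :=
  f (\top)%O = (\top)%O /\ forall x y, f (x `&` y)%O = (f x `&` f y)%O.

Record form := Form {
  clusters :> groupType -> tMeetSemilatticeType form_display;
  pull : forall X Y : groupType, hom X Y -> clusters Y -> clusters X;
  pull_meet : forall X Y (f : hom X Y), finite_meet_morphism (pull f);
  pull_id : forall X (A : clusters X), pull (id_hom X) A = A;
  pull_comp : forall X Y Z (g : hom Y Z) (f : hom X Y) (A : clusters Z),
    pull (comp_hom g f) A = pull f (pull g A) }.

(* A family (A_i, f_i)_i together with a candidate U for its final lift. *)
Record presentation (F : form) (X : groupType) := Presentation {
  idx : Type;
  src : idx -> groupType;
  arr : forall i, hom (src i) X;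
  cls : forall i, F (src i);
  lift : F X }.
Arguments src {F X} p i.
Arguments arr {F X} p i.
Arguments cls {F X} p i.

Definition is_final (F : form) X (P : presentation F X) : Prop :=
  (forall i, (cls P i <= pull (arr P i) (lift P))%O) /\
  (forall V : F X, (forall i, (cls P i <= pull (arr P i) V)%O) ->
     (lift P <= V)%O).

Definition unit_pres (F : form) X (A : F X) : presentation F X :=
  @Presentation F X unit (fun=> X) (fun=> id_hom X) (fun=> A) A.

Definition reindex (F : form) X (P : presentation F X) (J : Type)
    (e : J -> idx P) : presentation F X :=
  @Presentation F X J (fun j => src P (e j)) (fun j => arr P (e j))
    (fun j => cls P (e j)) (lift P).

Definition comp_pres (F : form) X (P : presentation F X)
    (Q : forall i : idx P, presentation F (src P i)) : presentation F X :=
  @Presentation F X {i : idx P & idx (Q i)}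
    (fun ij => src (Q (projT1 ij)) (projT2 ij))
    (fun ij => comp_hom (arr P (projT1 ij)) (arr (Q (projT1 ij)) (projT2 ij)))
    (fun ij => cls (Q (projT1 ij)) (projT2 ij)) (lift P).

Definition meet_pres (F : form) X (P : presentation F X) (C : F X) :
    presentation F X :=
  @Presentation F X (idx P) (src P) (arr P)
    (fun i => (cls P i `&` pull (arr P i) C)%O) (lift P `&` C)%O.

Definition map_pres (F G : form) (u : forall X, F X -> G X) X
    (P : presentation F X) : presentation G X :=
  @Presentation G X (idx P) (src P) (arr P)
    (fun i => u _ (cls P i)) (u X (lift P)).

Record dform := DForm {
  dform_form :> form;
  admissible : forall X, presentation dform_form X -> Prop;
  admissible_final : forall X (P : presentation dform_form X),
    admissible P -> is_final P;
  admissible_unit : forall X (A : dform_form X), admissible (unit_pres A);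
  admissible_reindex : forall X (P : presentation dform_form X) (J : Type)
    (e : J -> idx P), bijective e -> admissible P -> admissible (reindex e);
  admissible_comp : forall X (P : presentation dform_form X)
    (Q : forall i : idx P, presentation dform_form (src P i)),
    admissible P -> (forall i, admissible (Q i)) ->
    (forall i, lift (Q i) = cls P i) -> admissible (comp_pres Q);
  admissible_meet : forall X (P : presentation dform_form X) (C : dform_form X),
    admissible P -> admissible (meet_pres P C) }.

Record dmor (F G : dform) := DMor {
  dmor_app :> forall X, F X -> G X;
  dmor_natural : forall X Y (f : hom X Y) (A : F Y),
    dmor_app (pull f A) = pull f (dmor_app A);
  dmor_meet : forall X, finite_meet_morphism (@dmor_app X);
  dmor_admissible : forall X (P : presentation F X),
    admissible P -> admissible (map_pres dmor_app P) }.

Lemma dmor_ext (F G : dform) (u v : dmor F G) :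
  (forall X (A : F X), u X A = v X A) -> u = v.
Proof.
move=> uv; have : dmor_app u = dmor_app v.
  by apply: functional_extensionality_dep => X; apply/funext => A.
case: u v {uv} => u ? ? ? [v ? ? ?] /= uv; subst v.
by congr DMor; exact: Prop_irrelevance.
Qed.

Definition dmor_id (F : dform) : dmor F F.
Proof. by apply: (@DMor F F (fun X A => A)) => // X [*]. Defined.

Definition dmor_comp (F G H : dform) (v : dmor G H) (u : dmor F G) : dmor F H.
Proof.
apply: (@DMor F H (fun X A => v X (u X A))) => [X Y f A|X|X P aP].
- by rewrite !dmor_natural.
- have [u1 uI] := dmor_meet u X; have [v1 vI] := dmor_meet v X.
  by split=> [|x y]; rewrite ?u1 ?v1 ?uI ?vI.
- exact: (dmor_admissible v (dmor_admissible u aP)).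
Defined.

(* The minimal distributivity: only unit presentations are admissible, up to the
   bijective reindexings required of any admissible class. *)
Inductive unit_admissible (F : form) X : presentation F X -> Prop :=
  UnitAdmissible (A : F X) (J : Type) (e : J -> unit) :
    bijective e -> unit_admissible (@reindex F X (unit_pres A) J e).

Section Minimal.
Variable F : form.

Lemma unit_admissible_final X (P : presentation F X) :
  unit_admissible P -> is_final P.
Proof.
case=> A J e [g _ _]; split=> [j|V /(_ (g tt))] /=; rewrite pull_id //.
Qed.

Lemma unit_admissible_unit X (A : F X) : unit_admissible (unit_pres A).
Proof.
have bid : bijective (@id unit) by exists id.
exact: (@UnitAdmissible F X A unit id bid).
Qed.

Lemma unit_admissible_reindex X (P : presentation F X) (J : Type)
  (e : J -> idx P) : bijective e -> unit_admissible P -> unit_admissible (reindex e).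
Proof.
move=> be uP; case: uP e be => A I d bd e be.
exact: (@UnitAdmissible F X A J (d \o e) (bij_comp bd be)).
Qed.

Lemma unit_admissible_comp X (P : presentation F X)
  (Q : forall i : idx P, presentation F (src P i)) :
  unit_admissible P -> (forall i, unit_admissible (Q i)) ->
  (forall i, lift (Q i) = cls P i) -> unit_admissible (comp_pres Q).
Proof.
move=> uP; case: uP Q => A I d bd Q uQ /= lQ.
have {uQ lQ} /choice[J JP] i :
    exists Je : {J : Type & {e : J -> unit | bijective e}}, Q i = @reindex F X (unit_pres A) (projT1 Je) (sval (projT2 Je)).
  have := lQ i; case: (uQ i) => B J e be /= <-.
  by exists (existT _ J (exist _ e be)).
have {JP}-> : Q = fun i =>
    @reindex F X (unit_pres A) (projT1 (J i)) (sval (projT2 (J i))).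
  exact/functional_extensionality_dep.
have -> : @comp_pres F X (@reindex F X (unit_pres A) I d)
    (fun i => @reindex F X (unit_pres A) (projT1 (J i)) (sval (projT2 (J i)))) =
  @reindex F X (unit_pres A) {i : I & projT1 (J i)} (fun=> tt).
  rewrite /comp_pres /reindex /=; congr Presentation.
  by apply/funext => ij; apply: hom_ext.
apply: UnitAdmissible.
case: bd => g gd dg.
have [h hK Kh] := proj2_sig (projT2 (J (g tt))).
exists (fun=> existT _ (g tt) (h tt)) => [[i j]|[]//].
have ei : g tt = i by rewrite -[RHS]gd; case: (d i).
case: _ / ei j => j; congr existT.
by rewrite -[RHS]hK; case: (sval _ _).
Qed.

Lemma unit_admissible_meet X (P : presentation F X) (C : F X) :
  unit_admissible P -> unit_admissible (meet_pres P C).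
Proof.
case=> A J e be.
have -> : meet_pres (@reindex F X (unit_pres A) J e) C =
    @reindex F X (unit_pres (A `&` C)%O) J e.
  rewrite /meet_pres /reindex /=; congr Presentation.
  by apply/funext => j; rewrite pull_id.
exact: UnitAdmissible.
Qed.

Definition minimal_dform : dform :=
  DForm unit_admissible_final unit_admissible_unit unit_admissible_reindex
    unit_admissible_comp unit_admissible_meet.

End Minimal.

Definition null (F G : dform) (n : dmor F G) : Prop :=
  forall X (A : F X), n X A = (\top)%O.

Definition is_kernel (K F G : dform) (k : dmor K F) (u : dmor F G) : Prop :=
  null (dmor_comp u k) /\
  forall (H : dform) (h : dmor H F), null (dmor_comp u h) ->
    exists! h' : dmor H K, dmor_comp k h' = h.

Definition is_cokernel (F G C : dform) (c : dmor G C) (u : dmor F G) : Prop :=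
  null (dmor_comp c u) /\
  forall (H : dform) (h : dmor G H), null (dmor_comp h u) ->
    exists! h' : dmor C H, dmor_comp h' c = h.

Record short_exact (F : dform) := ShortExact {
  ses_ker : dform;
  ses_quo : dform;
  ses_k : dmor ses_ker F;
  ses_q : dmor F ses_quo;
  ses_kernel : is_kernel ses_k ses_q;
  ses_cokernel : is_cokernel ses_q ses_k }.

Definition dmor_iso (F G : dform) (u : dmor F G) : Prop :=
  exists v : dmor G F, dmor_comp v u = dmor_id F /\ dmor_comp u v = dmor_id G.

Definition ses_iso (F : dform) (S T : short_exact F) : Prop :=
  exists (a : dmor (ses_ker S) (ses_ker T)) (b : dmor (ses_quo S) (ses_quo T)),
    [/\ dmor_iso a, dmor_iso b, dmor_comp (ses_k T) a = ses_k S
      & dmor_comp b (ses_q S) = ses_q T].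

(* An isomorphism class, fixing F, of short exact sequences; it is a plain
   predicate rather than a [set] only because of universe levels. *)
Record ext_pres (F : dform) := ExtPres {
  ext_class : short_exact F -> Prop;
  ext_classP : exists S, forall T, ext_class T <-> ses_iso S T }.

Definition kernel_subform (F : dform) (E : ext_pres F) (X : groupType)
    (A : F X) : Prop :=
  exists2 S, ext_class E S & ses_q S X A = (\top)%O.

Definition hausdorff_object (F : dform) (E : ext_pres F) (X : groupType) : Prop :=
  exists b : F X, (forall A : F X, (b <= A)%O) /\
    (forall A, kernel_subform E A -> (b <= A)%O) /\
    (forall c : F X, (forall A, kernel_subform E A -> (c <= A)%O) -> (c <= b)%O).

Lemma kernel_subformP (F : dform) (E : ext_pres F) :
  exists S : short_exact F, forall X (A : F X),
    kernel_subform E A <-> ses_q S X A = (\top)%O.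
Proof.
have [S ES] := ext_classP E; exists S => X A; split=> [[T /ES]|SA].
  move=> [a] [b] [_ [v [vb _]] _ bq] TA.
  have bA : b X (ses_q S X A) = (\top)%O.
    by rewrite -TA -bq.
  have vbA : v X (b X (ses_q S X A)) = ses_q S X A.
    exact: (f_equal (fun w : dmor _ _ => w X (ses_q S X A)) vb).
  by rewrite -vbA bA; case: (dmor_meet v X).
exists S => //; apply/ES; exists (dmor_id _), (dmor_id _).
have idK G : dmor_iso (dmor_id G).
  by exists (dmor_id G); split; exact: dmor_ext.
by split=> //; exact: dmor_ext.
Qed.

Record subgroup (G : groupType) := Subgroup {
  subgroup_set :> set G;
  subgroup1 : subgroup_set 1;
  subgroupM : forall x y, subgroup_set x -> subgroup_set y -> subgroup_set (x * y);
  subgroupV : forall x, subgroup_set x -> subgroup_set x^-1 }.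

Lemma subgroup_ext (G : groupType) (U V : subgroup G) :
  (U : set G) = (V : set G) -> U = V.
Proof.
case: U V => U ? ? ? [V ? ? ?] /= UV; subst V.
by congr Subgroup; exact: Prop_irrelevance.
Qed.

Definition normal_subgroup (G : groupType) (N : subgroup G) : Prop :=
  forall x y, subgroup_set N x -> subgroup_set N (x ^ y).

Section Quotient.
Variables (G : groupType) (N : subgroup G) (nN : normal_subgroup N).

Definition coset_rel (x y : G) : bool := `[< subgroup_set N (x^-1 * y) >].

Fact coset_rel_refl : reflexive coset_rel.
Proof. by move=> x; apply/asboolP; rewrite mulVg; exact: subgroup1. Qed.

Fact coset_rel_sym : symmetric coset_rel.
Proof.
move=> x y; apply/asboolP/asboolP => /subgroupV; by rewrite invgM invgK.
Qed.

Fact coset_rel_trans : transitive coset_rel.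
Proof.
move=> y x z /asboolP xy /asboolP yz; apply/asboolP.
by have := subgroupM xy yz; rewrite mulgA mulgK.
Qed.

Canonical coset_equiv := EquivRel coset_rel coset_rel_refl coset_rel_sym
  coset_rel_trans.

(* The normality proof is a parameter of the type G/N so that the group instance
   below can be inferred from the type alone. *)
Definition quotient_group := let _ := nN in {eq_quot coset_equiv}%qT.

HB.instance Definition _ := Choice.copy quotient_group {eq_quot coset_equiv}%qT.

Definition coset_class (x : G) : quotient_group :=
  (\pi_{eq_quot coset_equiv} x)%qT.
Definition coset_repr (a : quotient_group) : G :=
  generic_quotient.repr (a : {eq_quot coset_equiv}%qT).

Lemma coset_reprK a : coset_class (coset_repr a) = a.
Proof. exact: (@reprK _ {eq_quot coset_equiv}%qT). Qed.

Lemma coset_classP x y : coset_class x = coset_class y <-> subgroup_set N (x^-1 * y).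
Proof.
split=> [/eqP|xy].
  by rewrite /coset_class (@eqmodE _ coset_equiv) => /asboolP.
by apply/eqP; rewrite /coset_class (@eqmodE _ coset_equiv); apply/asboolP.
Qed.

Definition quo_one : quotient_group := coset_class 1.
Definition quo_inv (a : quotient_group) := coset_class (coset_repr a)^-1.
Definition quo_mul (a b : quotient_group) :=
  coset_class (coset_repr a * coset_repr b).

Lemma quo_mulE x y : quo_mul (coset_class x) (coset_class y) = coset_class (x * y).
Proof.
apply/coset_classP.
have /coset_classP Nx := coset_reprK (coset_class x).
have /coset_classP Ny := coset_reprK (coset_class y).
set x' := coset_repr _ in Nx *; set y' := coset_repr _ in Ny *.
have -> : (x' * y')^-1 * (x * y) = (x'^-1 * x) ^ y' * (y'^-1 * y).
  by rewrite conjgE invgM !mulgA mulgK.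
by apply: subgroupM => //; exact: nN.
Qed.

Lemma quo_invE x : quo_inv (coset_class x) = coset_class x^-1.
Proof.
apply/coset_classP.
have /coset_classP := coset_reprK (coset_class x).
set x' := coset_repr _ => Nx; rewrite invgK.
have -> : x' * x^-1 = ((x'^-1 * x) ^ x'^-1)^-1.
  by rewrite conjgE !invgM !invgK !mulgA mulgK.
by apply: subgroupV; exact: nN.
Qed.

Fact quo_mulA : associative quo_mul.
Proof.
move=> a b c; rewrite -(coset_reprK a) -(coset_reprK b) -(coset_reprK c).
by rewrite !quo_mulE mulgA.
Qed.

Fact quo_mul1g : left_id quo_one quo_mul.
Proof. by move=> a; rewrite -(coset_reprK a) quo_mulE mul1g. Qed.

Fact quo_mulg1 : right_id quo_one quo_mul.
Proof. by move=> a; rewrite -(coset_reprK a) quo_mulE mulg1. Qed.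

Fact quo_mulVg : left_inverse quo_one quo_inv quo_mul.
Proof. by move=> a; rewrite -(coset_reprK a) quo_invE quo_mulE mulVg. Qed.

Fact quo_mulgV : right_inverse quo_one quo_inv quo_mul.
Proof. by move=> a; rewrite -(coset_reprK a) quo_invE quo_mulE mulgV. Qed.

HB.instance Definition _ := isGroup.Build quotient_group
  quo_mulA quo_mul1g quo_mulg1 quo_mulVg quo_mulgV.

End Quotient.

Section SubgroupOrder.
Variable G : groupType.

HB.instance Definition _ := gen_eqMixin (subgroup G).
HB.instance Definition _ := gen_choiceMixin (subgroup G).

Definition subgroup_le (U V : subgroup G) : bool := `[< U `<=` V >].

Fact subgroup_le_refl : reflexive subgroup_le.
Proof. by move=> U; apply/asboolP. Qed.

Fact subgroup_le_anti : antisymmetric subgroup_le.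
Proof.
move=> U V /andP[/asboolP UV /asboolP VU].
by apply: subgroup_ext; apply/seteqP.
Qed.

Fact subgroup_le_trans : transitive subgroup_le.
Proof.
move=> V U W /asboolP UV /asboolP VW.
by apply/asboolP; exact: subset_trans VW.
Qed.

HB.instance Definition _ := Order.Le_isPOrder.Build form_display (subgroup G)
  subgroup_le_refl subgroup_le_anti subgroup_le_trans.

Definition subgroup_meet (U V : subgroup G) : subgroup G.
Proof.
exists (U `&` V) => [|x y [? ?] [? ?]|x [? ?]].
- by split; exact: subgroup1.
- by split; exact: subgroupM.
- by split; exact: subgroupV.
Defined.

Definition subgroup_top : subgroup G :=
  @Subgroup G setT I (fun _ _ _ _ => I) (fun _ _ => I).

Fact subgroup_meetP (U V W : subgroup G) :
  (U <= subgroup_meet V W)%O = (U <= V)%O && (U <= W)%O.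
Proof.
apply/asboolP/andP => [|[/asboolP UV /asboolP UW] x Ux]; last first.
  by split; [exact: UV|exact: UW].
by move=> UVW; split; apply/asboolP => x /UVW [].
Qed.

HB.instance Definition _ := Order.POrder_isMeetSemilattice.Build form_display
  (subgroup G) subgroup_meetP.

Fact subgroup_le_top (U : subgroup G) : (U <= subgroup_top)%O.
Proof. by apply/asboolP. Qed.

HB.instance Definition _ := Order.hasTop.Build form_display (subgroup G)
  subgroup_le_top.

End SubgroupOrder.

Definition subgroup_preim (G H : groupType) (f : hom G H) (U : subgroup H) :
  subgroup G.
Proof.
exists (f @^-1` U) => [|x y Ux Uy|x Ux] /=.
- by rewrite gmulf1; exact: subgroup1.
- by rewrite gmulfM; exact: subgroupM.
- by rewrite gmulfV; exact: subgroupV.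
Defined.

Definition subgroup_form : form.
Proof.
apply: (@Form (fun G => subgroup G : tMeetSemilatticeType _) subgroup_preim).
- by move=> G H f; split=> [|U V]; exact: subgroup_ext.
- by move=> G U; exact: subgroup_ext.
- by move=> G H L g f U; exact: subgroup_ext.
Defined.

Definition Sub : dform := minimal_dform subgroup_form.

Record topology_on (G : groupType) := TopologyOn {
  opens : set (set G);
  opensT : opens setT;
  opensI : forall A B, opens A -> opens B -> opens (A `&` B);
  opens_bigU : forall C : set (set G), C `<=` opens -> opens (\bigcup_(A in C) A) }.

Definition topologized (G : groupType) (t : topology_on G) : Type := G.

Section Topologized.
Variables (G : groupType) (t : topology_on G).

HB.instance Definition _ := Group.copy (topologized t) G.

Fact topologized_bigU (I : Type) (f : I -> set (topologized t)) :
  (forall i, opens t (f i)) -> opens t (\bigcup_i f i).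
Proof.
move=> fO; have -> : \bigcup_i f i = \bigcup_(A in range f) A.
  by rewrite bigcup_image.
by apply: opens_bigU => _ [i _ <-].
Qed.

HB.instance Definition _ := isOpenTopological.Build (topologized t)
  (opensT t) (@opensI G t) topologized_bigU.

End Topologized.

Definition group_topology (G : groupType) (t : topology_on G) : Prop :=
  continuous (fun p : topologized t * topologized t => p.1 * p.2) /\
  continuous (fun x : topologized t => x^-1).

Definition non_archimedean (G : groupType) (t : topology_on G) : Prop :=
  group_topology t /\
  nbhs (1 : topologized t) =
    filter_from [set U : subgroup G | open (U : set (topologized t))]
                (fun U => U : set G).

Section AssociatedTopology.
Variables (E : ext_pres Sub) (G : groupType).

Definition assoc_open (O : set G) : Prop :=
  forall x, O x -> exists2 U : Sub G, kernel_subform E U &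
    forall u, subgroup_set U u -> O (x * u).

Fact assoc_openT : assoc_open setT.
Proof.
move=> x _; have [S SE] := kernel_subformP E; exists (\top)%O => //.
by apply/SE; case: (dmor_meet (ses_q S) G).
Qed.

Fact assoc_openI A B : assoc_open A -> assoc_open B -> assoc_open (A `&` B).
Proof.
have [S SE] := kernel_subformP E.
move=> oA oB x [/oA[U /SE kU UA] /oB[V /SE kV VB]].
exists (U `&` V)%O => [|u [Uu Vu]]; last by split; [exact: UA|exact: VB].
by apply/SE; case: (dmor_meet (ses_q S) G) => _ ->; rewrite kU kV meetxx.
Qed.

Fact assoc_open_bigU (C : set (set G)) :
  C `<=` assoc_open -> assoc_open (\bigcup_(A in C) A).
Proof.
move=> CO x [A CA Ax]; have [U kU UA] := CO _ CA _ Ax.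
by exists U => // u /UA ?; exists A.
Qed.

Definition assoc_topology : topology_on G :=
  TopologyOn assoc_openT assoc_openI assoc_open_bigU.

End AssociatedTopology.

Record pseudovariety (K : finGroupType -> Prop) : Prop := Pseudovariety {
  (* A class of groups is closed under isomorphism; subgroups, products and
     quotients are given below by one particular model each. *)
  pv_iso : forall gT rT : finGroupType,
    K gT -> [set: gT]%SET \isog [set: rT]%SET -> K rT;
  pv_prod : forall (I : finType) (gT : I -> finGroupType),
    (forall i, K (gT i)) -> K {dffun forall i, gT i};
  pv_sub : forall (gT : finGroupType) (H : {group gT}), K gT -> K (subg_of H);
  pv_quo : forall (gT : finGroupType) (N : {group gT}),
    N <| [set: gT]%SET -> K gT -> K (coset_of N) }.

(* An abstract group is in K when it is isomorphic to some [finGroupType] in K. *)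
Definition in_class (K : finGroupType -> Prop) (G : groupType) : Prop :=
  exists2 Q : finGroupType, K Q & exists f : hom G Q, bijective f.

Definition coclass_normal (K : finGroupType -> Prop) (G : groupType) :
    set (subgroup G) :=
  [set N : subgroup G |
    exists nN : normal_subgroup N, in_class K (quotient_group nN)].

Definition pro_filter (K : finGroupType -> Prop) (G : groupType) :
    set (subgroup G) :=
  [set U : subgroup G |
    exists2 N : subgroup G, coclass_normal K N & N `<=` U].

Definition pro_topology (K : finGroupType -> Prop) (G : groupType)
    (t : topology_on G) : Prop :=
  group_topology t /\
  nbhs (1 : topologized t) =
    filter_from (@coclass_normal K G) (fun N : subgroup G => N : set G).

Definition residually (K : finGroupType -> Prop) (G : groupType) : Prop :=
  forall x : G, x <> 1 ->
    exists2 Q : finGroupType, K Q & exists f : hom G Q, f x <> 1.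

(* [top] is meant to pin down a single topology on each group: the third clause
   gives both its existence and its uniqueness. *)
Definition presented_by (N : forall G : groupType, set (subgroup G))
    (top : forall G : groupType, topology_on G -> Prop)
    (res : groupType -> Prop) : Prop :=
  exists E : ext_pres Sub,
    [/\ forall (G : groupType) (U : Sub G), kernel_subform E U <-> N G U,
        forall G : groupType, non_archimedean (assoc_topology E G),
        forall (G : groupType) (t : topology_on G),
          top G t <-> t = assoc_topology E G
      & forall G : groupType, hausdorff_object E G <-> res G].

Definition finite_groups (Q : finGroupType) : Prop := True.
Definition p_groups (p : nat) (Q : finGroupType) : Prop := p.-group [set: Q]%SET.
Definition solvable_groups (Q : finGroupType) : Prop := solvable [set: Q]%SET.
Definition nilpotent_groups (Q : finGroupType) : Prop := nilpotent [set: Q]%SET.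

Definition profinite_topology := pro_topology finite_groups.
Definition pro_p_topology (p : nat) := pro_topology (p_groups p).
Definition prosolvable_topology := pro_topology solvable_groups.
Definition pronilpotent_topology := pro_topology nilpotent_groups.

Definition residually_finite (G : groupType) : Prop :=
  forall x : G, x <> 1 -> exists (Q : finGroupType) (f : hom G Q), f x <> 1.

Definition residually_finite_p (p : nat) (G : groupType) : Prop :=
  forall x : G, x <> 1 -> exists2 Q : finGroupType, p.-group [set: Q]%SET &
    exists f : hom G Q, f x <> 1.

Definition residually_finite_solvable (G : groupType) : Prop :=
  forall x : G, x <> 1 -> exists2 Q : finGroupType, solvable [set: Q]%SET &
    exists f : hom G Q, f x <> 1.

Definition residually_finite_nilpotent (G : groupType) : Prop :=
  forall x : G, x <> 1 -> exists2 Q : finGroupType, nilpotent [set: Q]%SET &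
    exists f : hom G Q, f x <> 1.

(* Main.v *)
From HB Require Import structures.
From mathcomp Require Import all_boot all_order all_fingroup all_solvable.
From mathcomp Require Import boolp classical_sets.
From mathcomp Require Import topology.
Require Import Defs.

(** The theorem separates into three independent facts.

    The first is about forms only.  Let [N] select in every [F X] a filter
    (containing the top, closed under meets and upwards) and be stable under
    pullback.  Then [N] is the kernel of a short exact sequence: put [A] below
    [B] modulo [N] when [A `&` U <= B] for some [U] in [N], and let the quotient
    form have as clusters the classes of this preorder.  A class is the top
    exactly when it comes from [N], so the inclusion of [N] is the kernel of the
    projection; and a finite-meet map that kills [N] is monotone for the new
    preorder, so it factors through the projection, which is therefore the
    cokernel of the inclusion.  Both outer terms are given the minimal
    distributivity.  A map out of a minimally distributive form preserves
    admissibility automatically, which settles the cokernel; for the kernel one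
    also needs that admissibility in the minimal sense is reflected by
    componentwise injective maps ([unit_admissible_reflect]).  This gives
    [filter_ext_pres] and [filter_kernel_subform].

    The second is about topologies on a group.  Stability under pullback along
    inner automorphisms makes the topology of such an [N] a group topology, in
    which the open subgroups are precisely the members of [N]; so it is
    non-Archimedean ([assoc_non_archimedean]).  A group topology is determined
    by the neighbourhoods of the identity ([group_topology_eq]), which reduces
    the comparison with the pro-K topology to the fact that the normal
    subgroups with quotient in K are cofinal in [N].

    The third is about pseudovarieties.  By the first isomorphism theorem and
    closure under subgroups, the normal subgroups with quotient in K are exactly
    the kernels of homomorphisms to members of K ([coclass_normalP]).  Hence [U]
    lies in the pro-K filter iff it contains the kernel of such a homomorphism
    ([pro_filterP]).  In this form the filter axioms are immediate: the empty
    product in K gives the top, a binary product gives meets, and composition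
    gives pullbacks.  It also turns the Hausdorff condition, that the
    intersection of the filter is trivial, into being residually K
    ([pro_hausdorffP]).

    For the four named classes it remains to check the closure properties.  Only
    products require an argument: a subset of a product is trivial as soon as
    its projections are, so a product of solvable or nilpotent groups has its
    derived or lower central series reach 1 at the maximum of the lengths. *)

Set Implicit Arguments.
Unset Strict Implicit.
Unset Printing Implicit Defensive.

Import Order.TTheory.

Local Open Scope classical_set_scope.
Local Open Scope group_scope.

(** * Admissibility in minimally distributive forms *)

(** The part of a presentation that does not mention the form.  It is shared by
    a presentation and its image under a natural transformation, so conditions
    on it are transported without any dependent rewriting. *)
Definition skeleton (X : groupType) : Type :=
  {J : Type & {s : J -> groupType & forall j, hom (s j) X}}.

Definition skeleton_of (F : form) X (P : presentation F X) : skeleton X :=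
  existT _ (idx P) (existT _ (src P) (arr P)).

Definition unit_skeleton X (J : Type) : skeleton X :=
  existT _ J (existT _ (fun=> X) (fun=> id_hom X)).

Definition on_skeleton (F : form) X (k : skeleton X)
    (c : forall j, F (projT1 (projT2 k) j)) (A : F X) : presentation F X :=
  @Presentation F X (projT1 k) (projT1 (projT2 k)) (projT2 (projT2 k)) c A.

(** Minimal admissibility only constrains the skeleton and demands that every
    cluster be the pullback of the lift; unlike the inductive definition, this
    can be compared between two forms. *)
Lemma unit_admissibleP (F : form) X (P : presentation F X) :
  unit_admissible P <->
  [/\ exists e : idx P -> unit, bijective e,
      exists J, skeleton_of P = unit_skeleton X J
    & forall i, cls P i = pull (arr P i) (lift P)].
Proof.
split=> [[A J e be]|[[e be] [J kP] cP]].
  by split=> [||i /=]; [exists e|exists J|rewrite pull_id].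
(* Every component is expressed through the skeleton, which can then be replaced
   by the unit skeleton in one step. *)
have PE : P = on_skeleton (k := skeleton_of P) (cls P) (lift P).
  by case: P {be kP cP e}.
rewrite PE; move: (cls P) (lift P) cP; rewrite -/(arr P).
rewrite -[arr P]/(projT2 (projT2 (skeleton_of P))).
rewrite -[idx P]/(projT1 (skeleton_of P)) in e be *.
rewrite -[src P]/(projT1 (projT2 (skeleton_of P))).
move: e be; rewrite {}kP => /= e be c A cA.
have -> : c = fun=> A by apply/funext => i; rewrite cA pull_id.
exact: (@UnitAdmissible F X A J e be).
Qed.

(** The skeleton is untouched and naturality carries over the equation between
    clusters and lift. *)
Lemma unit_admissible_map (F G : form) (u : forall X, F X -> G X) X
    (P : presentation F X) :
  (forall X Y (f : hom X Y) A, u X (pull f A) = pull f (u Y A)) ->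
  unit_admissible P -> unit_admissible (map_pres u P).
Proof.
move=> uN /unit_admissibleP[eP kP cP]; apply/unit_admissibleP.
by split=> // i; rewrite /= cP uN.
Qed.

(** Converse of the previous lemma; injectivity is what allows the equation
    between clusters and lift to be read back in the source. *)
Lemma unit_admissible_reflect (F G : form) (u : forall X, F X -> G X) X
    (P : presentation F X) :
  (forall X Y (f : hom X Y) A, u X (pull f A) = pull f (u Y A)) ->
  (forall X, injective (u X)) ->
  unit_admissible (map_pres u P) -> unit_admissible P.
Proof.
move=> uN uI /unit_admissibleP[eP kP cP]; apply/unit_admissibleP.
by split=> // i; apply: uI; rewrite uN; apply: cP.
Qed.

Lemma unit_admissible_in (G : dform) X (P : presentation G X) :
  unit_admissible P -> admissible P.
Proof. by case=> A J e be; apply: admissible_reindex (admissible_unit A). Qed.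

(** Units are admissible in every distributivity form, so out of a minimally
    distributive form a morphism is no more than a natural family of finite-meet
    maps. *)
Definition minimal_dmor (F : form) (G : dform) (u : forall X, F X -> G X)
  (uN : forall X Y (f : hom X Y) A, u X (pull f A) = pull f (u Y A))
  (uM : forall X, finite_meet_morphism (u X)) : dmor (minimal_dform F) G :=
  @DMor (minimal_dform F) G u uN uM
    (fun X P aP => unit_admissible_in (unit_admissible_map uN aP)).

(** * The kernel and quotient of a stable family of filters *)

Record stable_filter (F : form) := StableFilter {
  in_filter :> forall X, F X -> Prop;
  filter_top : forall X, in_filter (\top : F X)%O;
  filter_meet : forall X (A B : F X),
    in_filter A -> in_filter B -> in_filter (A `&` B)%O;
  filter_up : forall X (A B : F X), (A <= B)%O -> in_filter A -> in_filter B;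
  filter_pull : forall X Y (f : hom X Y) (A : F Y),
    in_filter A -> in_filter (pull f A) }.

Section KernelForm.
Variables (F : form) (N : stable_filter F).

Record filter_cluster (X : groupType) :=
  FilterCluster { filter_val : F X; filter_valP : N X filter_val }.

Lemma filter_val_inj X : injective (@filter_val X).
Proof.
move=> [A NA] [B NB] /= AB; subst B; congr FilterCluster.
exact: Prop_irrelevance.
Qed.

HB.instance Definition _ X := gen_eqMixin (filter_cluster X).
HB.instance Definition _ X := gen_choiceMixin (filter_cluster X).

Definition filter_cluster_le X (A B : filter_cluster X) : bool :=
  (filter_val A <= filter_val B)%O.

Fact filter_cluster_le_refl X : reflexive (@filter_cluster_le X).
Proof. by move=> A; apply: lexx. Qed.

Fact filter_cluster_le_anti X : antisymmetric (@filter_cluster_le X).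
Proof. by move=> A B /le_anti/filter_val_inj. Qed.

Fact filter_cluster_le_trans X : transitive (@filter_cluster_le X).
Proof. by move=> B A C; apply: le_trans. Qed.

HB.instance Definition _ X := Order.Le_isPOrder.Build form_display
  (filter_cluster X) (@filter_cluster_le_refl X) (@filter_cluster_le_anti X)
  (@filter_cluster_le_trans X).

Definition filter_cluster_meet X (A B : filter_cluster X) : filter_cluster X :=
  FilterCluster (filter_meet (filter_valP A) (filter_valP B)).

Fact filter_cluster_meetP X (A B C : filter_cluster X) :
  (A <= filter_cluster_meet B C)%O = (A <= B)%O && (A <= C)%O.
Proof. exact: lexI. Qed.

HB.instance Definition _ X := Order.POrder_isMeetSemilattice.Build form_display
  (filter_cluster X) (@filter_cluster_meetP X).

Definition filter_cluster_top X : filter_cluster X :=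
  FilterCluster (filter_top N X).

Fact filter_cluster_le_top X (A : filter_cluster X) :
  (A <= filter_cluster_top X)%O.
Proof. exact: lex1. Qed.

HB.instance Definition _ X := Order.hasTop.Build form_display (filter_cluster X)
  (@filter_cluster_le_top X).

Definition filter_cluster_pull X Y (f : hom X Y) (A : filter_cluster Y) :
    filter_cluster X :=
  FilterCluster (filter_pull f (filter_valP A)).

Definition kernel_form : form.
Proof.
apply: (@Form (fun X => filter_cluster X : tMeetSemilatticeType _)
  filter_cluster_pull).
- move=> X Y f; have [f1 fI] := pull_meet F f.
  by split=> [|A B]; apply: filter_val_inj; [exact: f1|exact: fI].
- by move=> X A; apply: filter_val_inj; rewrite /= pull_id.
- by move=> X Y Z g f A; apply: filter_val_inj; rewrite /= pull_comp.
Defined.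

Definition filter_incl : dmor (minimal_dform kernel_form) (minimal_dform F) :=
  @minimal_dmor kernel_form (minimal_dform F) filter_val
    (fun _ _ _ _ => erefl) (fun _ => conj erefl (fun _ _ => erefl)).

End KernelForm.

Section QuotientForm.
Variables (F : form) (N : stable_filter F).

(** Inclusion up to the filter: the quotient is the localisation of [F X] that
    forces every member of [N] to be the top. *)
Definition le_mod X (A B : F X) : Prop := exists2 U, N X U & (A `&` U <= B)%O.

Lemma le_mod_le X (A B : F X) : (A <= B)%O -> le_mod A B.
Proof. by move=> AB; exists (\top)%O; [exact: filter_top|rewrite meetx1]. Qed.

Lemma le_mod_trans X (B A C : F X) : le_mod A B -> le_mod B C -> le_mod A C.
Proof.
move=> [U NU AUB] [V NV BVC]; exists (U `&` V)%O; first exact: filter_meet.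
by rewrite meetA; apply: le_trans BVC; apply: leI2.
Qed.

Lemma le_mod_meet X (A B C : F X) :
  le_mod A (B `&` C)%O <-> le_mod A B /\ le_mod A C.
Proof.
split=> [ABC|[[U NU AUB] [V NV AVC]]].
  by split; apply: le_mod_trans ABC _; apply: le_mod_le; rewrite ?leIl ?leIr.
exists (U `&` V)%O; first exact: filter_meet.
rewrite lexI (le_trans _ AUB) ?(le_trans _ AVC) //;
  by rewrite leI2 // ?leIl ?leIr.
Qed.

Lemma le_mod_pull X Y (f : hom X Y) (A B : F Y) :
  le_mod A B -> le_mod (pull f A) (pull f B).
Proof.
have [_ fI] := pull_meet F f.
move=> [U NU AUB]; exists (pull f U); first exact: filter_pull.
by rewrite -fI leEmeet -fI; move/meet_idPl: AUB => ->.
Qed.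

(** This is where upward closure of the filter enters: it makes the kernel of
    the projection equal to [N] and not larger. *)
Lemma le_mod_top X (A : F X) : le_mod (\top)%O A <-> N X A.
Proof.
split=> [[U NU]|NA]; first by rewrite meet1x => /filter_up; apply.
by exists A; rewrite ?meet1x.
Qed.

Definition eq_mod X (A B : F X) : bool := `[< le_mod A B /\ le_mod B A >].

Fact eq_mod_refl X : reflexive (@eq_mod X).
Proof. by move=> A; apply/asboolP; split; apply: le_mod_le. Qed.

Fact eq_mod_sym X : symmetric (@eq_mod X).
Proof. by move=> A B; apply/asboolP/asboolP => -[]. Qed.

Fact eq_mod_trans X : transitive (@eq_mod X).
Proof.
move=> B A C /asboolP[AB BA] /asboolP[BC CB].
by apply/asboolP; split; apply: (le_mod_trans (B := B)).
Qed.

Canonical eq_mod_equiv X :=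
  EquivRel (@eq_mod X) (@eq_mod_refl X) (@eq_mod_sym X) (@eq_mod_trans X).

Definition quo_cluster X := {eq_quot (eq_mod_equiv X)}%qT.

HB.instance Definition _ X := Choice.copy (quo_cluster X)
  {eq_quot (eq_mod_equiv X)}%qT.

Definition quo_class X (A : F X) : quo_cluster X :=
  (\pi_{eq_quot (eq_mod_equiv X)} A)%qT.
Definition quo_repr X (a : quo_cluster X) : F X :=
  generic_quotient.repr (a : {eq_quot (eq_mod_equiv X)}%qT).

Lemma quo_reprK X (a : quo_cluster X) : quo_class (quo_repr a) = a.
Proof. exact: (@reprK _ {eq_quot (eq_mod_equiv X)}%qT). Qed.

Lemma quo_classP X (A B : F X) :
  quo_class A = quo_class B <-> le_mod A B /\ le_mod B A.
Proof.
split=> [/eqP|AB].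
  by rewrite /quo_class (@eqmodE _ (eq_mod_equiv X)) => /asboolP.
by apply/eqP; rewrite /quo_class (@eqmodE _ (eq_mod_equiv X)); apply/asboolP.
Qed.

Definition quo_le X (a b : quo_cluster X) : bool :=
  `[< le_mod (quo_repr a) (quo_repr b) >].

Fact quo_le_refl X : reflexive (@quo_le X).
Proof. by move=> a; apply/asboolP/le_mod_le. Qed.

Fact quo_le_anti X : antisymmetric (@quo_le X).
Proof.
move=> a b /andP[/asboolP ab /asboolP ba].
by rewrite -(quo_reprK a) -(quo_reprK b); apply/quo_classP.
Qed.

Fact quo_le_trans X : transitive (@quo_le X).
Proof.
by move=> b a c /asboolP ab /asboolP bc; apply/asboolP/(le_mod_trans ab).
Qed.

HB.instance Definition _ X := Order.Le_isPOrder.Build form_display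
  (quo_cluster X) (@quo_le_refl X) (@quo_le_anti X) (@quo_le_trans X).

Lemma quo_leE X (A B : F X) :
  (quo_class A <= quo_class B)%O <-> le_mod A B.
Proof.
have /quo_classP[AA' A'A] := quo_reprK (quo_class A).
have /quo_classP[BB' B'B] := quo_reprK (quo_class B).
split=> [/asboolP|] AB; [|apply/asboolP].
  exact: le_mod_trans A'A (le_mod_trans AB BB').
exact: le_mod_trans AA' (le_mod_trans AB B'B).
Qed.

Definition quo_meet X (a b : quo_cluster X) : quo_cluster X :=
  quo_class (quo_repr a `&` quo_repr b)%O.

Fact quo_meetP X (a b c : quo_cluster X) :
  (a <= quo_meet b c)%O = (a <= b)%O && (a <= c)%O.
Proof.
rewrite -{1}(quo_reprK a); apply/idP/andP.
  by move=> /quo_leE/le_mod_meet[ab ac]; split; apply/asboolP.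
by move=> [/asboolP ab /asboolP ac]; apply/quo_leE/le_mod_meet.
Qed.

HB.instance Definition _ X := Order.POrder_isMeetSemilattice.Build form_display
  (quo_cluster X) (@quo_meetP X).

Definition quo_top X : quo_cluster X := quo_class (\top)%O.

Fact quo_le_top X (a : quo_cluster X) : (a <= quo_top X)%O.
Proof. by rewrite -(quo_reprK a); apply/quo_leE/le_mod_le/lex1. Qed.

HB.instance Definition _ X := Order.hasTop.Build form_display (quo_cluster X)
  (@quo_le_top X).

Lemma quo_class_meet X : finite_meet_morphism (@quo_class X).
Proof.
split=> // A B; apply/quo_classP.
have /quo_classP[AA' A'A] := quo_reprK (quo_class A).
have /quo_classP[BB' B'B] := quo_reprK (quo_class B).
split; apply/le_mod_meet; split.
- exact: le_mod_trans (le_mod_le (leIl _ _)) A'A.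
- exact: le_mod_trans (le_mod_le (leIr _ _)) B'B.
- exact: le_mod_trans (le_mod_le (leIl _ _)) AA'.
- exact: le_mod_trans (le_mod_le (leIr _ _)) BB'.
Qed.

Definition quo_pull X Y (f : hom X Y) (a : quo_cluster Y) : quo_cluster X :=
  quo_class (pull f (quo_repr a)).

Lemma quo_pullE X Y (f : hom X Y) (A : F Y) :
  quo_pull f (quo_class A) = quo_class (pull f A).
Proof.
have /quo_classP[AA' A'A] := quo_reprK (quo_class A).
by apply/quo_classP; split; apply: le_mod_pull.
Qed.

Definition quotient_form : form.
Proof.
apply: (@Form (fun X => quo_cluster X : tMeetSemilatticeType _) quo_pull).
- move=> X Y f; have [f1 fI] := pull_meet F f.
  have [_ qI] := quo_class_meet X; have [_ qI'] := quo_class_meet Y.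
  split=> [|a b]; first by rewrite quo_pullE f1.
  rewrite -(quo_reprK a) -(quo_reprK b) -qI' !quo_pullE fI; exact: qI.
- by move=> X a; rewrite -(quo_reprK a) quo_pullE pull_id.
- by move=> X Y Z g f a; rewrite -(quo_reprK a) !quo_pullE pull_comp.
Defined.

Definition quo_proj : dmor (minimal_dform F) (minimal_dform quotient_form) :=
  @minimal_dmor F (minimal_dform quotient_form) quo_class
    (fun _ _ f A => esym (quo_pullE f A)) quo_class_meet.

Lemma quo_proj_top X (A : F X) : quo_proj X A = (\top)%O <-> N X A.
Proof.
rewrite -le_mod_top; split=> [/quo_classP[]//|NA]; apply/quo_classP; split=> //.
exact/le_mod_le/lex1.
Qed.

End QuotientForm.

Section ShortExact.
Variables (F : form) (N : stable_filter F).

(** A map killed by the projection takes values in [N] by [quo_proj_top], so it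
    corestricts; the corestriction preserves admissibility because the inclusion
    reflects it. *)
Lemma filter_incl_kernel : is_kernel (filter_incl N) (quo_proj N).
Proof.
split=> [X A|H h qh0]; first exact/quo_proj_top/filter_valP.
have hN X (A : H X) : N X (h X A) by apply/quo_proj_top; exact: qh0.
pose h' X (A : H X) : kernel_form N X := FilterCluster (hN X A).
have h'N X Y (f : hom X Y) A : h' X (pull f A) = pull f (h' Y A).
  by apply: filter_val_inj; rewrite /= dmor_natural.
have h'M X : finite_meet_morphism (h' X).
  have [h1 hI] := dmor_meet h X.
  by split=> [|A B]; apply: filter_val_inj; [exact: h1|exact: hI].
have h'A X (P : presentation H X) : admissible P ->
    admissible (d := minimal_dform (kernel_form N)) (map_pres h' P).
  move=> /(dmor_admissible h) hP.
  apply: (unit_admissible_reflect (F := kernel_form N) (G := F)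
    (u := @filter_val F N) (P := map_pres h' P)) hP => //.
  exact: filter_val_inj.
exists (@DMor H (minimal_dform (kernel_form N)) h' h'N h'M h'A).
split=> [|g gh]; first exact: dmor_ext.
apply: dmor_ext => X A; apply: filter_val_inj => /=.
by rewrite -gh.
Qed.

(** If [h] sends [N] to the top then [A `&` U <= B] with [U] in [N] yields
    [h A = h (A `&` U) <= h B], so [h] depends only on classes modulo [N]. *)
Lemma quo_proj_cokernel : is_cokernel (quo_proj N) (filter_incl N).
Proof.
split=> [X A|H h hk0]; first exact/quo_proj_top/filter_valP.
have h1 X U : N X U -> h X U = (\top)%O.
  by move=> NU; have := hk0 X (FilterCluster NU).
have h_le X A B : le_mod N A B -> (h X A <= h X B)%O.
  have [_ hI] := dmor_meet h X.
  move=> [U /h1 hU AUB]; rewrite leEmeet -[h X A]meetx1 -hU -hI -hI.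
  by move/meet_idPl: AUB => ->.
pose h' X (a : quotient_form N X) : H X := h X (quo_repr a).
have h'E X (A : F X) : h' X (quo_class N A) = h X A.
  have /quo_classP[AA' A'A] := quo_reprK (quo_class N A).
  by apply/le_anti; rewrite !h_le.
have h'N X Y (f : hom X Y) a : h' X (pull f a) = pull f (h' Y a).
  by rewrite -(quo_reprK a) /= quo_pullE !h'E dmor_natural.
have h'M X : finite_meet_morphism (h' X).
  have [hT hI] := dmor_meet h X; have [_ qI] := quo_class_meet N X.
  split=> [|a b]; first by rewrite -hT -h'E.
  by rewrite -(quo_reprK a) -(quo_reprK b) -qI !h'E hI.
exists (minimal_dmor h'N h'M); split=> [|g gh].
  by apply: dmor_ext => X A; apply: h'E.
apply: dmor_ext => X a; rewrite -(quo_reprK a) /= h'E.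
by rewrite -gh.
Qed.

Definition filter_ses : short_exact (minimal_dform F) :=
  ShortExact filter_incl_kernel quo_proj_cokernel.

Lemma filter_ext_presP :
  exists S, forall T, ses_iso filter_ses T <-> ses_iso S T.
Proof. by exists filter_ses. Qed.

Definition filter_ext_pres : ext_pres (minimal_dform F) :=
  ExtPres filter_ext_presP.

End ShortExact.

(** An isomorphism of quotient terms preserves the top, so all representatives
    of an extensional presentation define the same kernel subform. *)
Lemma ses_iso_top (F : dform) (S T : short_exact F) X (A : F X) :
  ses_iso S T -> ses_q T X A = (\top)%O -> ses_q S X A = (\top)%O.
Proof.
move=> [a [b [_ [v [vb _]] _ bq]]] TA.
have -> : ses_q S X A = v X (b X (ses_q S X A)).
  exact: (f_equal (fun w : dmor _ _ => w X (ses_q S X A)) (esym vb)).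
rewrite -[b X _]/(dmor_comp b (ses_q S) X A) bq TA.
by case: (dmor_meet v X).
Qed.

Lemma ses_iso_refl (F : dform) (S : short_exact F) : ses_iso S S.
Proof.
have idK G : dmor_iso (dmor_id G).
  by exists (dmor_id G); split; apply: dmor_ext.
by exists (dmor_id _), (dmor_id _); split=> //; apply: dmor_ext.
Qed.

Lemma filter_kernel_subform (F : form) (N : stable_filter F) X (A : F X) :
  kernel_subform (filter_ext_pres N) A <-> N X A.
Proof.
split=> [[T ST TA]|NA]; first exact/quo_proj_top/(ses_iso_top ST).
by exists (filter_ses N); [exact: ses_iso_refl|exact/quo_proj_top].
Qed.

(** * Group topologies *)

Definition make_hom (G H : groupType) (f : G -> H) (f1 : f 1 = 1)
    (fM : {morph f : x y / x * y}) : hom G H :=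
  HB.pack f (isUMagmaMorphism.Build G H f (f1, fM)).

Definition conj_hom (G : groupType) (y : G) : hom G G :=
  make_hom (conj1g y) (fun u v => conjMg u v y).

Section GroupTopology.
Variable G : groupType.

Lemma topology_on_ext (t t' : topology_on G) :
  (forall A, opens t A <-> opens t' A) -> t = t'.
Proof.
case: t t' => o oT oI oU [o' oT' oI' oU'] /= oo'.
have {oo'} oo' : o = o' by apply/funext => A; apply/propext.
by subst o'; congr TopologyOn; exact: Prop_irrelevance.
Qed.

(** Left translations are homeomorphisms: continuity of multiplication gives one
    direction, and translating back by the inverse gives the other. *)
Lemma nbhs_translate (t : topology_on G) (x : topologized t) A :
  group_topology t ->
  nbhs x A <-> nbhs (1 : topologized t) [set u | A (x * u)].
Proof.
move=> [mulC _].
have trC (y z : topologized t) :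
    ((fun u : topologized t => y * u) @ z --> y * z).
  move=> B /(mulC (y, z)) [[C D] /= [yC zD] CDB].
  apply: (filterS _ zD) => u Du; apply: (CDB (y, u)); split=> //.
  exact: nbhs_singleton yC.
split=> [xA|A1].
  by have := trC x 1 A; rewrite mulg1; apply.
have : nbhs x [set u | A (x * (x^-1 * u))].
  by apply: (trC x^-1 x [set u | A (x * u)]); rewrite mulVg.
by apply: filterS => u /=; rewrite mulKVg.
Qed.

Lemma group_topology_eq (t t' : topology_on G) :
  group_topology t -> group_topology t' ->
  nbhs (1 : topologized t) = nbhs (1 : topologized t') -> t = t'.
Proof.
move=> gt gt' tt'; apply: topology_on_ext => A.
have opensE s : opens s A <-> forall x, A x -> nbhs (x : topologized s) A.
  rewrite -[opens s A]/(open (A : set (topologized s))) openE.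
  by split.
split=> /opensE oA; apply/opensE => x /oA.
  move=> /(nbhs_translate _ _ gt).1; rewrite tt'.
  by move=> /(nbhs_translate _ _ gt').2.
move=> /(nbhs_translate _ _ gt').1; rewrite -tt'.
by move=> /(nbhs_translate _ _ gt).2.
Qed.

End GroupTopology.

Section AssociatedTopology.
Variables (N : stable_filter subgroup_form) (G : groupType).

Local Notation E := (filter_ext_pres N).
Local Notation T := (topologized (assoc_topology E G)).

(** A left coset [x U] with [U] in the filter is open, since around each of its
    points [y] it contains [y U]. *)
Lemma assoc_nbhsP (x : T) A :
  nbhs x A <->
  exists2 U : subgroup G, N G U & forall u, subgroup_set U u -> A (x * u).
Proof.
split=> [|[U NU xUA]].
  rewrite nbhsE => -[O [/= oO Ox] OA].
  have [U /filter_kernel_subform NU xUO] := oO x Ox.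
  by exists U => // u /xUO /OA.
rewrite nbhsE; exists [set y | subgroup_set U (x^-1 * y)].
  split; last by rewrite /= mulVg; exact: subgroup1.
  move=> y /= Uy; exists U; first exact/filter_kernel_subform.
  by move=> u Uu; rewrite mulgA; exact: subgroupM.
by move=> y /= /xUA; rewrite mulKVg.
Qed.

(** To absorb [(x u) (y v)] into [x y U] one needs [u ^ y] in [U], and to absorb
    [(x u)^-1] into [x^-1 U] one needs the conjugate of [u] by [x^-1] in [U].
    Both hold for [u] in the pullback of [U] along an inner automorphism, which
    is again in the filter. *)
Lemma assoc_group_topology : group_topology (assoc_topology E G).
Proof.
split=> [[x y] A /assoc_nbhsP[U NU xyUA]|x A /assoc_nbhsP[U NU xUA]].
  pose c : hom G G := conj_hom (y : G).
  exists ([set z | subgroup_set (subgroup_preim c U) (x^-1 * z)],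
          [set z | subgroup_set U (y^-1 * z)]) => /=.
    split; apply/assoc_nbhsP.
      exists (subgroup_preim c U); first exact: (filter_pull c).
      by move=> u; rewrite /= mulKg.
    by exists U => // u; rewrite /= mulKg.
  move=> [a b] /= [Ua Ub].
  have -> : a * b = x * y * ((x^-1 * a) ^ y * (y^-1 * b)).
    by rewrite conjgE !mulgA mulgK mulgK mulgV mul1g.
  exact/xyUA/subgroupM.
pose c : hom G G := conj_hom (x^-1 : G).
apply/assoc_nbhsP; exists (subgroup_preim c U); first exact: (filter_pull c).
move=> u /= /subgroupV /xUA; congr A.
by rewrite conjgE invgK !invgM invgK !mulgA mulVg mul1g.
Qed.

Lemma assoc_open_subgroupP (U : subgroup G) :
  open (U : set T) <-> N G U.
Proof.
split=> [oU|NU].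
  have [V /filter_kernel_subform NV VU] := oU 1 (subgroup1 U).
  apply: filter_up NV; apply/asboolP => v /VU; by rewrite mul1g.
move=> x Ux; exists U; first exact/filter_kernel_subform.
by move=> u; exact: subgroupM.
Qed.

Lemma assoc_non_archimedean : non_archimedean (assoc_topology E G).
Proof.
split; first exact: assoc_group_topology.
apply/seteqP; split=> A.
  move=> /assoc_nbhsP[U NU UA]; exists U; first exact/assoc_open_subgroupP.
  by move=> u /UA; rewrite mul1g.
move=> [U /assoc_open_subgroupP NU UA]; apply/assoc_nbhsP.
by exists U => // u /UA; rewrite mul1g.
Qed.

End AssociatedTopology.

(** * Hausdorff objects *)

Definition trivial_subgroup (G : groupType) : subgroup G.
Proof.
by exists [set 1] => // [x y -> ->|x ->]; rewrite /= ?mulg1 ?invg1.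
Defined.

Lemma trivial_subgroup_le (G : groupType) (U : subgroup G) :
  (trivial_subgroup G <= U)%O.
Proof. by apply/asboolP => _ ->; exact: subgroup1. Qed.

Definition filter_inter (N : stable_filter subgroup_form) (G : groupType) :
  subgroup G.
Proof.
exists [set y | forall U : subgroup G, N G U -> subgroup_set U y].
- by move=> U _; exact: subgroup1.
- by move=> y z yN zN U NU; apply: subgroupM; [exact: yN|exact: zN].
- by move=> y yN U NU; apply: subgroupV; exact: yN.
Defined.

(** The greatest lower bound of the filter among subgroups is its intersection,
    and the least subgroup is the trivial one. *)
Lemma hausdorff_objectP (N : stable_filter subgroup_form) (G : groupType) :
  hausdorff_object (filter_ext_pres N) G <->
  forall x : G, (forall U : subgroup G, N G U -> subgroup_set U x) -> x = 1.
Proof.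
split=> [[b [bmin [_ bmax]]] x xN|NG].
  pose c := filter_inter N G.
  have cb : (c <= b)%O.
    by apply: bmax => A /filter_kernel_subform NA; apply/asboolP => y yN;
      exact: yN.
  have /asboolP b1 : (b <= trivial_subgroup G)%O by exact: bmin.
  by apply/b1; move/asboolP: cb; apply.
exists (trivial_subgroup G); split; first exact: trivial_subgroup_le.
split=> [A _|c cN]; first exact: trivial_subgroup_le.
apply/asboolP => x cx; apply: NG => U /filter_kernel_subform NU.
by have /asboolP := cN _ NU; apply.
Qed.

(** * The filter of a pseudovariety *)

Section Image.
Variables (G : groupType) (Q : finGroupType) (f : hom G Q).

Definition hom_image : {set Q} := [set y : Q | `[< exists x, f x = y >]]%SET.

Lemma hom_imageP y : reflect (exists x, f x = y) (y \in hom_image).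
Proof. by rewrite finset.in_set; exact: asboolP. Qed.

Fact hom_image_group_set : group_set hom_image.
Proof.
apply/group_setP; split=> [|y z].
  by apply/hom_imageP; exists 1; rewrite gmulf1.
move=> /hom_imageP[a <-] /hom_imageP[b <-].
by apply/hom_imageP; exists (a * b); rewrite gmulfM.
Qed.

Canonical hom_image_group := Group hom_image_group_set.

Lemma mem_hom_image x : f x \in hom_image_group.
Proof. by apply/hom_imageP; exists x. Qed.

End Image.

(** First isomorphism theorem.  The image of a homomorphism to a member of [K]
    is in [K] as a subgroup, and conversely the isomorphism of the quotient with
    a member of [K] is composed with the projection. *)
Lemma coclass_normalP (K : finGroupType -> Prop) (G : groupType)
    (N : subgroup G) : pseudovariety K ->
  coclass_normal K N <->
  exists2 Q : finGroupType, K Q &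
    exists f : hom G Q, forall x, subgroup_set N x <-> f x = 1.
Proof.
move=> KP; split=> [[nN [Q KQ [g [g' gK _]]]]|[Q KQ [f fN]]].
  exists Q => //.
  have p1 : coset_class nN 1 = 1 by [].
  have pM : {morph coset_class nN : x y / x * y}.
    by move=> x y; rewrite -quo_mulE.
  exists (comp_hom g (make_hom p1 pM)) => x /=.
  have -> : subgroup_set N x <-> coset_class nN 1 = coset_class nN x.
    by rewrite coset_classP invg1 mul1g.
  split=> [<-|gx]; first exact: gmulf1.
  by rewrite p1; apply: (can_inj gK); rewrite gmulf1.
have nN : normal_subgroup N.
  move=> x y /fN fx; apply/fN.
  by rewrite conjgE !gmulfM fx mul1g -gmulfM mulVg gmulf1.
exists nN; exists (subg_of (hom_image_group f)); first exact: pv_sub.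
have fE x y : f x = f y <-> coset_class nN x = coset_class nN y.
  rewrite coset_classP fN gmulfM gmulfV; split=> [->|xy]; first exact: mulVg.
  by rewrite -[RHS](mulKVg (f x)) xy mulg1.
pose g (a : quotient_group nN) := subg (hom_image_group f) (f (coset_repr a)).
have gE x : g (coset_class nN x) = subg (hom_image_group f) (f x).
  by congr subg; apply/fE; rewrite coset_reprK.
have g1 : g 1 = 1.
  by rewrite gE gmulf1; apply: val_inj; rewrite /= subgK ?group1.
have gM : {morph g : a b / a * b}.
  move=> a b; rewrite -(coset_reprK a) -(coset_reprK b).
  rewrite -[_ * _]/(quo_mul _ _) quo_mulE !gE gmulfM.
  by apply: val_inj; rewrite /= !subgK ?groupM ?mem_hom_image.
exists (make_hom g1 gM).
have /choice[h hK] (z : subg_of (hom_image_group f)) : exists a, g a = z.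
  have /hom_imageP[x fx] := subgP z.
  by exists (coset_class nN x); rewrite gE fx sgvalK.
have gI : injective g.
  move=> a b; rewrite -(coset_reprK a) -(coset_reprK b) !gE => /(congr1 sgval).
  by rewrite !subgK ?mem_hom_image // => /fE.
by exists h => // a; apply: gI; rewrite hK.
Qed.

Section ProFilter.
Variables (K : finGroupType -> Prop) (KP : pseudovariety K).

Definition hom_kernel (G H : groupType) (f : hom G H) : subgroup G :=
  subgroup_preim f (trivial_subgroup H).

Lemma hom_kernel_coclass (G : groupType) (Q : finGroupType) (f : hom G Q) :
  K Q -> coclass_normal K (hom_kernel f).
Proof. by move=> KQ; apply/coclass_normalP => //; exists Q => //; exists f. Qed.

(** Membership in the filter without quotients: this is the form in which the
    closure properties of [K] apply directly. *)
Lemma pro_filterP (G : groupType) (U : subgroup G) :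
  pro_filter K U <->
  exists2 Q : finGroupType, K Q &
    exists f : hom G Q, forall x, f x = 1 -> subgroup_set U x.
Proof.
split=> [[N /(coclass_normalP _ KP)[Q KQ [f fN]] NU]|[Q KQ [f fU]]].
  by exists Q => //; exists f => x /fN/NU.
by exists (hom_kernel f); [exact: hom_kernel_coclass|exact: fU].
Qed.

(** The product over the empty family provides a member of any pseudovariety. *)
Lemma pro_filter_top (G : groupType) : pro_filter K (\top%O : subgroup_form G).
Proof.
pose gT (i : 'I_0) : finGroupType := {perm 'I_0}.
apply/pro_filterP; exists {dffun forall i : 'I_0, gT i}.
  by apply: pv_prod => // -[].
have f1 : (fun=> 1 : {dffun forall i, gT i}) (1 : G) = 1 by [].
by exists (make_hom f1 (fun _ _ => esym (mulg1 _))).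
Qed.

(** The kernel of the pairing of two homomorphisms is the intersection of their
    kernels, and its codomain, a binary product, stays in [K]. *)
Lemma pro_filter_meet (G : groupType) (U V : subgroup_form G) :
  pro_filter K U -> pro_filter K V -> pro_filter K (U `&` V)%O.
Proof.
move=> /pro_filterP[Q KQ [f fU]] /pro_filterP[R KR [g gV]].
pose gT b : finGroupType := if b then Q else R.
pose h (x : G) : {dffun forall b, gT b} :=
  [ffun b => if b as b return gT b then f x else g x].
have h1 : h 1 = 1 by apply/ffunP => -[]; rewrite !ffunE gmulf1.
have hM : {morph h : x y / x * y}.
  by move=> x y; apply/ffunP => -[]; rewrite !ffunE gmulfM.
apply/pro_filterP; exists {dffun forall b, gT b}.
  by apply: pv_prod => // -[].
exists (make_hom h1 hM) => x /= /ffunP hx; split.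
  by apply: fU; have := hx true; rewrite !ffunE.
by apply: gV; have := hx false; rewrite !ffunE.
Qed.

Lemma pro_filter_up (G : groupType) (U V : subgroup_form G) :
  (U <= V)%O -> pro_filter K U -> pro_filter K V.
Proof.
by move=> /asboolP UV [N KN NU]; exists N => //; apply: subset_trans UV.
Qed.

Lemma pro_filter_pull (G H : groupType) (f : hom G H) (U : subgroup_form H) :
  pro_filter K U -> pro_filter K (pull f U).
Proof.
move=> /pro_filterP[Q KQ [g gU]]; apply/pro_filterP; exists Q => //.
by exists (comp_hom g f) => x /gU.
Qed.

Definition pro_stable_filter : stable_filter subgroup_form :=
  StableFilter pro_filter_top pro_filter_meet pro_filter_up pro_filter_pull.

Lemma assoc_pro_topology (G : groupType) :
  pro_topology K (assoc_topology (filter_ext_pres pro_stable_filter) G).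
Proof.
split; first exact: assoc_group_topology.
apply/seteqP; split=> A.
  move=> /assoc_nbhsP[U [N KN NU] UA]; exists N => // x /NU/UA.
  by rewrite mul1g.
move=> [N KN NA]; apply/assoc_nbhsP; exists N; first by exists N.
by move=> u /NA; rewrite mul1g.
Qed.

Lemma pro_topologyP (G : groupType) (t : topology_on G) :
  pro_topology K t <-> t = assoc_topology (filter_ext_pres pro_stable_filter) G.
Proof.
have [gE nE] := assoc_pro_topology G.
split=> [[gt nt]|->]; last by split.
by apply: group_topology_eq => //; rewrite nt nE.
Qed.

(** An element outside the kernel of some homomorphism to a member of [K] is the
    same as an element outside some member of the filter. *)
Lemma pro_hausdorffP (G : groupType) :
  hausdorff_object (filter_ext_pres pro_stable_filter) G <-> residually K G.
Proof.
rewrite hausdorff_objectP; split=> [NG x x1|res x xN].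
  apply: contrapT => nQ; apply: x1; apply: NG => U /pro_filterP[Q KQ [f fU]].
  apply: fU; apply: contrapT => fx; apply: nQ; exists Q => //; by exists f.
apply: contrapT => /res[Q KQ [f]]; apply.
by apply: (xN (hom_kernel f)); apply/pro_filterP; exists Q => //; exists f.
Qed.

Lemma pro_presented :
  presented_by (pro_filter K) (pro_topology K) (residually K).
Proof.
exists (filter_ext_pres pro_stable_filter); split=> G.
- by move=> U; exact: filter_kernel_subform.
- exact: assoc_non_archimedean.
- exact: pro_topologyP.
- exact: pro_hausdorffP.
Qed.

End ProFilter.

(** * Classical pseudovarieties *)

(** Closure properties are usually available for groups inside an ambient finite
    group; each model used by [pseudovariety] is isomorphic to such a group. *)
Lemma pseudovariety_of (P : forall gT : finGroupType, {group gT} -> Prop) :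
  (forall (gT rT : finGroupType) (G : {group gT}) (H : {group rT}),
     G \isog H -> P gT G -> P rT H) ->
  (forall (gT : finGroupType) (G H : {group gT}),
     H \subset G -> P gT G -> P gT H) ->
  (forall (gT : finGroupType) (G N : {group gT}), P gT G -> P _ (G / N)%G) ->
  (forall (I : finType) (gT : I -> finGroupType),
     (forall i, P (gT i) [set: gT i]%G) ->
     P {dffun forall i, gT i} [set: {dffun forall i, gT i}]%G) ->
  pseudovariety (fun Q => P Q [set: Q]%G).
Proof.
move=> Pisog Psub Pquo Pprod; split=> // [gT rT PG GR|gT H PG|gT N nN PG].
- exact: (Pisog _ _ [group of [set: gT]%SET] [group of [set: rT]%SET]).
- exact: Pisog (isog_subg H) (Psub _ [set: gT]%G H (finset.subsetT _) PG).
- have -> : [set: coset_of N]%G = ([set: gT] / N)%G.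
    by apply/val_inj; rewrite /= quotientT.
  exact: Pquo.
Qed.

Lemma der_sub_leq (gT : finGroupType) (G : {group gT}) m n :
  (m <= n)%N -> G^`(n) \subset G^`(m).
Proof.
move/subnK <-; elim: {n}(n - m)%N => // k.
exact: fintype.subset_trans (der_subS _ _).
Qed.

Section Product.
Variables (I : finType) (gT : I -> finGroupType).
Local Notation Q := {dffun forall i, gT i}.

(** The projections are jointly injective. *)
Lemma dffun_sub1 (A : {set Q}) :
  (forall i, dffun_morphism gT i @* A \subset [1 gT i]) -> A \subset [1 Q].
Proof.
move=> A1; apply/fintype.subsetP => x Ax; apply/set1P/ffunP => i.
have /fintype.subsetP/(_ (x i)) := A1 i.
rewrite !ffunE => /(_ _)/set1P; apply.
by apply/morphimP; exists x; rewrite ?inE.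
Qed.

(** Projections map the derived series into the derived series, so the maximum
    of the derived lengths of the factors bounds that of the product. *)
Lemma dffun_solvable :
  (forall i, solvable [set: gT i]%SET) -> solvable [set: Q]%SET.
Proof.
move=> sol; have /fin_all_exists[n nP] i : exists n, [set: gT i]%SET^`(n) = 1.
  exact/derivedP.
apply/derivedP; exists (\max_i n i)%N; apply/trivgP; apply: dffun_sub1 => i.
rewrite morphim_der ?finset.subsetT // -(nP i).
apply: fintype.subset_trans (der_sub_leq _ (leq_bigmax i)).
exact/dergS/finset.subsetT.
Qed.

Lemma dffun_nilpotent :
  (forall i, nilpotent [set: gT i]%SET) -> nilpotent [set: Q]%SET.
Proof.
move=> nil; have /fin_all_exists[n nP] i :
    exists n, 'L_n.+1([set: gT i]%SET) = 1.
  exact/lcnP.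
apply/lcnP; exists (\max_i n i)%N; apply/trivgP; apply: dffun_sub1 => i.
rewrite morphim_lcn ?finset.subsetT // -(nP i).
apply: fintype.subset_trans (lcn_sub_leq _ (leq_bigmax i : n i < _.+1)%N).
exact/lcnS/finset.subsetT.
Qed.

Lemma dffun_pgroup p :
  (forall i, p.-group [set: gT i]%SET) -> p.-group [set: Q]%SET.
Proof.
move=> pg; rewrite /pgroup cardsT card_dep_ffun foldrE big_map.
elim/big_ind: _ => // [m n pm pn|i _]; first by rewrite pnatM pm.
by rewrite -cardsT; exact: pg.
Qed.

End Product.

Lemma finite_pseudovariety : pseudovariety finite_groups.
Proof. by split. Qed.

Lemma p_groups_pseudovariety p : pseudovariety (p_groups p).
Proof.
apply: (pseudovariety_of (P := fun gT (G : {group gT}) => p.-group G)).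
- by move=> gT rT G H /isog_pgroup ->.
- by move=> gT G H; exact: pgroupS.
- by move=> gT G N; exact: quotient_pgroup.
- by move=> I gT; exact: dffun_pgroup.
Qed.

Lemma solvable_pseudovariety : pseudovariety solvable_groups.
Proof.
apply: (pseudovariety_of (P := fun gT (G : {group gT}) => solvable G)).
- by move=> gT rT G H /isog_sol ->.
- by move=> gT G H; exact: solvableS.
- by move=> gT G N; exact: quotient_sol.
- by move=> I gT; exact: dffun_solvable.
Qed.

Lemma nilpotent_pseudovariety : pseudovariety nilpotent_groups.
Proof.
apply: (pseudovariety_of (P := fun gT (G : {group gT}) => nilpotent G)).
- by move=> gT rT G H /isog_nil ->.
- by move=> gT G H; exact: nilpotentS.
- by move=> gT G N; exact: quotient_nil.
- by move=> I gT; exact: dffun_nilpotent.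
Qed.

Lemma residually_finiteP G : residually finite_groups G <-> residually_finite G.
Proof.
by split=> res x /res; [move=> [Q _ [f fx]]|move=> [Q [f fx]]];
  exists Q => //; exists f.
Qed.

Theorem theorem3p8 :
  (forall K : finGroupType -> Prop,
     pseudovariety K -> (exists Q : finGroupType, K Q) ->
     presented_by (pro_filter K) (pro_topology K) (residually K)) /\
  (pseudovariety finite_groups /\
   presented_by (pro_filter finite_groups) profinite_topology
     residually_finite) /\
  (forall p : nat, prime p ->
   pseudovariety (p_groups p) /\
   presented_by (pro_filter (p_groups p)) (pro_p_topology p)
     (residually_finite_p p)) /\
  (pseudovariety solvable_groups /\
   presented_by (pro_filter solvable_groups) prosolvable_topology
     residually_finite_solvable) /\
  (pseudovariety nilpotent_groups /\
   presented_by (pro_filter nilpotent_groups) pronilpotent_topology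
     residually_finite_nilpotent).
Proof.
split; first by move=> K KP _; exact: pro_presented.
split.
  split; first exact: finite_pseudovariety.
  have [E [kE nE tE hE]] := pro_presented finite_pseudovariety.
  by exists E; split=> // G; rewrite hE residually_finiteP.
split.
  move=> p _; have pvp := p_groups_pseudovariety p.
  by split=> //; exact: pro_presented.
split; split.
- exact: solvable_pseudovariety.
- exact: (pro_presented solvable_pseudovariety).
- exact: nilpotent_pseudovariety.
- exact: (pro_presented nilpotent_pseudovariety).
Qed.
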